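(* Let $M\subset\mathbb N$ be a finite set, let $m$ be a positive integer, and let $X=(X_n)_{n\in\mathbb N}$ and $Y=(Y_n)_{n\in\mathbb N}$ be two pseudorandom number generators with the same output $M$ and the same period $m$. Let $u$ be a binary infinite word over $\{0,1\}$ having the WELLDOC property, and let $Z=(Z_n)_{n\in\mathbb N}$ be the pseudorandom number generator based on $u$ (combining $X$ and $Y$). Then $Z$ does not have the lattice structure.
   Context: A pseudorandom number generator (PRNG) is an infinite sequence of integers $Z=(Z_n)_{n\in\mathbb N}$; its output is the set of values it takes. $X$ has period $m$ means $X_{n+m}=X_n$ for all $n$. Lattice structure: a PRNG $Z$ with finite output $M\subset\mathbb N$ has the lattice structure if there exists a positive integer $t$ and a family of parallel equidistant hyperplanes in $\mathbb R^t$ (that is, a family $W_j=\{\mathbf x\in\mathbb R^t : \mathbf x\cdot\mathbf n=\alpha+jd\}$, $j\in\mathbb Z$, with $\mathbf n$ a unit vector, $\alpha\in\mathbb R$, $d>0$) whose union contains the set $\{(Z_i,Z_{i+1},\dots,Z_{i+t-1}) : i\in\mathbb N\}$ but does not contain the whole set $M^t=\{(A_1,\dots,A_t): A_i\in M \text{ for all } i\}$. Words: an infinite word $u=u_0u_1u_2\cdots$ is an infinite sequence of letters from a finite alphabet. It is aperiodic if it is not of the form $vw^\omega$ with $v,w$ finite words ($w$ nonempty; $w^\omega$ is the infinite repetition of $w$). A finite word $w$ is a factor of $u$ if $w=u_i u_{i+1}\cdots u_{i+|w|-1}$ for some $i$; each such index $i$ is an occurrence of $w$ in $u$. $\mathrm{Pref}_n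 u=u_0\cdots u_{n-1}$ is the prefix of length $n$, and $|v|_a$ is the number of occurrences of the letter $a$ in the finite word $v$. WELLDOC property: an aperiodic infinite word $u$ over $\{0,1,\dots,d-1\}$ has the WELLDOC property if for every positive integer $m$ and every factor $w$ of $u$, denoting by $i_0,i_1,\dots$ the occurrences of $w$ in $u$, one has $$\{(|\mathrm{Pref}_{i_j}u|_0,\dots,|\mathrm{Pref}_{i_j}u|_{d-1})\bmod m : j\in\mathbb N\}=\mathbb Z_m^d.$$ The PRNG $Z$ based on $u$: read the letters of $u$ one after another; when $0$ is read for the $i$-th time, append the $i$-th term of $X$ to $Z$; when $1$ is read for the $i$-th time, append the $i$-th term of $Y$ to $Z$. *)

(* Defs.v *)
From mathcomp Require Import all_boot all_order all_algebra.
From mathcomp Require Import all_classical all_reals.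

Set Implicit Arguments.
Unset Strict Implicit.
Unset Printing Implicit Defensive.

Import GRing.Theory Num.Theory.
Local Open Scope classical_set_scope.
Local Open Scope ring_scope.

Definition infword (A : Type) := nat -> A.

Definition word_cat (A : Type) (v : seq A) (u : infword A) : infword A :=
  fun n => nth (u (n - size v)%N) v n.

(* w^omega for the nonempty word w = a :: s *)
Definition omega_power (A : Type) (a : A) (s : seq A) : infword A :=
  fun n => nth a (a :: s) (n %% (size s).+1)%N.

Definition aperiodic (A : Type) (u : infword A) : Prop :=
  ~ exists (v : seq A) (a : A) (s : seq A),
      u =1 word_cat v (omega_power a s).

Definition occurrences (A : Type) (w : seq A) (u : infword A) : set nat :=
  [set i | w = [seq u (i + k)%N | k <- iota 0 (size w)]].

Definition factor (A : Type) (w : seq A) (u : infword A) : Prop :=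
  exists i, occurrences w u i.

Definition pref (A : Type) (n : nat) (u : infword A) : seq A := mkseq u n.

(* Z_m is represented by its residues 'I_m: the type 'Z_m would denote Z/2 for
   m = 1. *)
Definition parikh_mod (d m : nat) (m_gt0 : (0 < m)%N) (v : seq 'I_d) :
    'rV['I_m]_d :=
  \row_a Ordinal (ltn_pmod (count_mem a v) m_gt0).

Definition WELLDOC (d : nat) (u : infword 'I_d) : Prop :=
  aperiodic u /\
  forall (m : nat) (m_gt0 : (0 < m)%N) (w : seq 'I_d), factor w u ->
    [set parikh_mod m_gt0 (pref i u) | i in occurrences w u] = setT.

Definition prng := nat -> int.

Definition output (Z : prng) : set int := range Z.

Definition has_period (X : prng) (m : nat) : Prop :=
  forall n, X (n + m)%N = X n.

(* If u_n = a, this letter is preceded by |Pref_n u|_a letters a, so the term to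
   append is the one with 0-based index |Pref_n u|_a. *)
Definition combine (u : infword 'I_2) (X Y : prng) : prng :=
  fun n => if u n == 0 then X (count_mem (0 : 'I_2) (pref n u))
           else Y (count_mem (1 : 'I_2) (pref n u)).

Definition dot (R : realType) (t : nat) (x y : 'rV[R]_t) : R :=
  \sum_i x 0 i * y 0 i.

Definition unit_vector (R : realType) (t : nat) (x : 'rV[R]_t) : Prop :=
  Num.sqrt (dot x x) = 1.

Definition hyperplane (R : realType) (t : nat) (n : 'rV[R]_t) (alpha d : R)
    (j : int) : set 'rV[R]_t :=
  [set x | dot x n = alpha + j%:~R * d].

Definition cube (R : realType) (t : nat) (M : set int) : set 'rV[R]_t :=
  [set \row_(i < t) (A i)%:~R | A in [set A : 'I_t -> int | forall i, M (A i)]].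

Definition windows (R : realType) (t : nat) (Z : prng) : set 'rV[R]_t :=
  [set \row_(k < t) (Z (i + k)%N)%:~R | i in [set: nat]].

Definition lattice_structure (R : realType) (Z : prng) : Prop :=
  exists t : nat, (0 < t)%N /\
  exists (n : 'rV[R]_t) (alpha d : R),
    [/\ unit_vector n, 0 < d,
        @windows R t Z `<=` \bigcup_(j in [set: int]) hyperplane n alpha d j &
        ~ (@cube R t (output Z)
             `<=` \bigcup_(j in [set: int]) hyperplane n alpha d j)].

(* Main.v *)
Require Import Defs.
From mathcomp Require Import all_boot all_order all_algebra.
From mathcomp Require Import all_classical all_reals.

(** Call two real numbers congruent when they differ by an integer multiple of
    the distance [d] between consecutive hyperplanes, and let [n] be the normal
    vector.  The theorem follows from the claim that [(a - b) * n_k] is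
    congruent to 0 for every coordinate [k] and all values [a], [b] in the
    common output: then all points of the cube have congruent scalar products
    with [n], and since one of them (a window of the sequence) lies on the
    hyperplanes, all of them do.

    The claim is proved by descending induction on [k].  The key fact
    ([combine_branch]) is that for every length [l] and all values [a], [b]
    there are two windows of the combined sequence which agree on their first
    [l] terms and continue with [a] and [b] respectively.  With [l = k], the
    difference of the scalar products of [n] with these two windows is congruent
    to 0, its terms of index less than [k] vanish, and those of index greater
    than [k] are congruent to 0 by induction; hence so is the term
    [(a - b) * n_k].

    For the key fact, an aperiodic word has two occurrences of some factor [w]
    of length [l] which are followed by distinct letters
    ([aperiodic_right_special]).  For a binary word, both [w0] and [w1] are
    then factors.  By WELLDOC each of them has an occurrence before which the
    numbers of 0s and 1s have any prescribed residues mod [m]; taking the same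
    residues for both makes the terms read along [w] coincide, and the residues
    can be chosen so that the next term of [X] is [a] and the next term of [Y]
    is [b]. *)

Set Implicit Arguments.
Unset Strict Implicit.
Unset Printing Implicit Defensive.

Import GRing.Theory.
Local Open Scope classical_set_scope.
Local Open Scope ring_scope.

(** * Factors of infinite words *)

Lemma occurrences_mkseq (A : Type) (u v : infword A) (n i : nat) :
  occurrences (mkseq v n) u i <-> forall k, (k < n)%N -> u (i + k)%N = v k.
Proof.
rewrite /occurrences /= size_mkseq -/(mkseq _ _); split => [e k kn|e].
  by rewrite -(nth_mkseq (v k) v kn) e nth_mkseq.
by apply/eq_in_map => k; rewrite mem_iota add0n => /andP[_ /e ->].
Qed.

Lemma pref_add (A : Type) (u : infword A) (i k : nat) :
  pref (i + k) u = pref i u ++ mkseq (fun j => u (i + j)%N) k.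
Proof.
rewrite /pref /mkseq iotaD map_cat add0n -[X in iota X k]addn0 iotaDl.
by rewrite -map_comp.
Qed.

Lemma eventually_periodic_not_aperiodic (A : Type) (u : infword A) (i p : nat) :
  (0 < p)%N -> (forall n, u (i + n)%N = u (i + p + n)%N) -> ~ aperiodic u.
Proof.
case: p => // p _ per; apply; exists (pref i u), (u i).
exists (mkseq (fun k => u (i + k.+1)%N) p) => n.
rewrite /word_cat size_mkseq; have [ni|ni] := ltnP n i.
  by rewrite /pref nth_mkseq.
rewrite nth_default ?size_mkseq// /omega_power size_mkseq.
have perM q r : u (i + r)%N = u (i + (q * p.+1 + r))%N.
  elim: q => [|q ->]; first by rewrite mul0n.
  by rewrite per mulSn !addnA.
have -> : u n = u (i + (n - i) %% p.+1)%N.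
  by rewrite (perM ((n - i) %/ p.+1)%N) -divn_eq subnKC.
have := ltn_pmod (n - i) (ltn0Sn p).
case: (_ %% _)%N => [|r] rp; first by rewrite addn0.
by rewrite /= nth_mkseq.
Qed.

(** Otherwise each letter would be determined by the [l] letters before it, and
    a repeated factor of length [l] would make the word eventually periodic. *)
Lemma aperiodic_right_special (A : finType) (u : infword A) (l : nat) :
  aperiodic u ->
  exists i j, (forall k, (k < l)%N -> u (i + k)%N = u (j + k)%N) /\
    u (i + l)%N <> u (j + l)%N.
Proof.
move=> ap; apply: contrapT => noRS.
have det i j : (forall k, (k < l)%N -> u (i + k)%N = u (j + k)%N) ->
    u (i + l)%N = u (j + l)%N.
  by move=> e; apply: contrapT => ne; apply: noRS; exists i, j.
(* More positions than words of length [l]: two of them carry the same word. *)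
pose win (i : 'I_(#|{: l.-tuple A}|).+1) : l.-tuple A :=
  [tuple u (i + k)%N | k < l].
have [i [j [ltij wij]]] : exists i j : nat, (i < j)%N /\
    forall k, (k < l)%N -> u (i + k)%N = u (j + k)%N.
  have /injectivePn[i [j neq e]] : ~~ injectiveb win.
    apply/negP => /injectiveP /leq_card.
    by rewrite card_ord ltnn.
  have w k : (k < l)%N -> u (i + k)%N = u (j + k)%N.
    by move=> kl; have := congr1 (fun v => tnth v (Ordinal kl)) e; rewrite !tnth_mktuple.
  have [lt|lt|/val_inj eij] := ltngtP (i : nat) j.
  - by exists i, j.
  - by exists j, i; split=> // k /w.
  - by rewrite eij eqxx in neq.
have per n : u (i + n)%N = u (j + n)%N.
  elim/ltn_ind: n => n IH; have [/wij//|ln] := ltnP n l.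
  have := det (i + (n - l))%N (j + (n - l))%N.
  rewrite -!addnA subnK//; apply=> k kl; rewrite -!addnA; apply: IH.
  by rewrite -[ltnRHS](subnK ln) ltn_add2l.
apply: (@eventually_periodic_not_aperiodic _ u i (j - i)) ap => [|n].
  by rewrite subn_gt0.
by rewrite subnKC ?per// ltnW.
Qed.

(** * Branching of the combined sequence *)

Lemma has_period_eqmod (X : prng) (m i j : nat) :
  has_period X m -> i = j %[mod m] -> X i = X j.
Proof.
move=> per; have XM q r : X (q * m + r)%N = X r.
  by elim: q => [|q IH]; rewrite ?mul0n// mulSn -addnA addnC per.
by move=> e; rewrite (divn_eq i m) (divn_eq j m) !XM e.
Qed.

(** A value of [X] can be reached [c] steps after an index determined by its
    residue mod [m] alone. *)
Lemma output_residue (X : prng) (m c : nat) (a : int) :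
  (0 < m)%N -> has_period X m -> output X a ->
  exists p, forall n, n = p %[mod m] -> X (n + c)%N = a.
Proof.
move=> m_gt0 per [r _ <-].
(* [m.-1 * c] stands for [- c] modulo [m]. *)
exists (r + m.-1 * c)%N => n e.
apply: (has_period_eqmod per).
by rewrite -modnDml e modnDml -addnA addnC -mulSnr prednK// mulnC modnMDl.
Qed.

(** WELLDOC with the prescribed residues given by arbitrary natural numbers
    [p a]. *)
Lemma WELLDOC_occurrence (d m : nat) (u : infword 'I_d) (w : seq 'I_d)
    (p : 'I_d -> nat) :
  WELLDOC u -> (0 < m)%N -> Defs.factor w u ->
  exists2 i, occurrences w u i &
    forall a, count_mem a (pref i u) = p a %[mod m].
Proof.
move=> [_ wd] m_gt0 /(wd m m_gt0) wT.
pose v : 'rV['I_m]_d := \row_a Ordinal (ltn_pmod (p a) m_gt0).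
have : [set: 'rV['I_m]_d] v by [].
rewrite -wT => -[i iw e]; exists i => // a.
by move/rowP/(_ a)/(congr1 val): e; rewrite !mxE.
Qed.

Lemma combine_congr (u : infword 'I_2) (X Y : prng) (m i j : nat) :
  has_period X m -> has_period Y m -> u i = u j ->
  (forall a, count_mem a (pref i u) = count_mem a (pref j u) %[mod m]) ->
  combine u X Y i = combine u X Y j.
Proof.
move=> perX perY uij cij; rewrite /combine uij.
by case: ifP => _; [apply: has_period_eqmod perX _|apply: has_period_eqmod perY _].
Qed.

Lemma output_combine (u : infword 'I_2) (X Y : prng) :
  output (combine u X Y) `<=` output X `|` output Y.
Proof.
by move=> _ [i _ <-]; rewrite /combine; case: ifP => _; [left|right]; eexists.
Qed.

Lemma ord2_eq1 (x : 'I_2) : x != 0 -> x = 1.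
Proof. by case: x => -[|[|//]] // h _; apply: val_inj. Qed.

Lemma binary_right_special (u : infword 'I_2) (l : nat) : aperiodic u ->
  exists i j, [/\ forall k, (k < l)%N -> u (j + k)%N = u (i + k)%N,
    u (i + l)%N = 0 & u (j + l)%N = 1].
Proof.
move=> /(@aperiodic_right_special _ u l)[i [j [e ne]]].
have [ui|/ord2_eq1 ui] := eqVneq (u (i + l)%N) 0.
  exists i, j; split=> // [k /e//|].
  by apply: ord2_eq1; apply/eqP => uj; apply: ne; rewrite ui uj.
exists j, i; split=> //; apply: contrapT => /eqP/ord2_eq1 uj.
by apply: ne; rewrite ui uj.
Qed.

(** After a suitable common context of any length [l], the combined sequence
    can continue with any term of [X] and with any term of [Y]. *)
Lemma combine_branch (m : nat) (X Y : prng) (u : infword 'I_2) (l : nat)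
    (a b : int) (Z := combine u X Y) :
  (0 < m)%N -> has_period X m -> has_period Y m -> WELLDOC u ->
  output X a -> output Y b ->
  exists i j, [/\ forall k, (k < l)%N -> Z (i + k)%N = Z (j + k)%N,
    Z (i + l)%N = a & Z (j + l)%N = b].
Proof.
move=> m_gt0 perX perY wd Xa Yb.
have [i0 [j0 [eij ui uj]]] := @binary_right_special u l wd.1.
pose w := mkseq (fun k => u (i0 + k)%N) l.
have [p pX] := output_residue (count_mem (0 : 'I_2) w) m_gt0 perX Xa.
have [q qY] := output_residue (count_mem (1 : 'I_2) w) m_gt0 perY Yb.
(* Numbers of 0s and 1s, modulo [m], prescribed before both occurrences. *)
pose r (x : 'I_2) := if x == 0 then p else q.
have occ h0 : exists2 i, forall k, (k < l.+1)%N -> u (i + k)%N = u (h0 + k)%N &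
    forall x, count_mem x (pref i u) = r x %[mod m].
  have [|i /occurrences_mkseq iw ir] := @WELLDOC_occurrence 2 m u
    (mkseq (fun k => u (h0 + k)%N) l.+1) r wd m_gt0.
    by exists h0; apply/occurrences_mkseq.
  by exists i.
have [[i ei ri] [j ej rj]] := (occ i0, occ j0).
have wi k : (k < l)%N -> u (i + k)%N = u (i0 + k)%N.
  by move=> kl; rewrite ei// ltnW.
have wj k : (k < l)%N -> u (j + k)%N = u (i0 + k)%N.
  by move=> kl; rewrite ej ?eij// ltnW.
have mkseqE h k : (k <= l)%N ->
    (forall k', (k' < l)%N -> u (h + k')%N = u (i0 + k')%N) ->
    mkseq (fun k' => u (h + k')%N) k = mkseq (fun k' => u (i0 + k')%N) k.
  move=> kl wh; apply/eq_in_map => k'; rewrite mem_iota add0n => /andP[_ k'k].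
  by apply: wh; apply: leq_trans kl.
exists i, j; split.
- move=> k kl; apply: (combine_congr perX perY) => [|x]; first by rewrite wi ?wj.
  rewrite !pref_add !count_cat !mkseqE ?(ltnW kl)//.
  by rewrite -modnDml ri -rj modnDml.
- rewrite /Z /combine ei// ui eqxx pref_add count_cat mkseqE//.
  exact/pX/ri.
- rewrite /Z /combine ej// uj /= pref_add count_cat mkseqE//.
  exact/qY/rj.
Qed.

(** * Hyperplanes and scalar products *)

(** The real numbers congruent to 0, that is, the subgroup of integer multiples
    of [d]. *)
Definition int_multiples (R : realType) (d : R) : set R :=
  [set j%:~R * d | j in [set: int]].

Section IntMultiples.
Variables (R : realType) (d : R).

Lemma int_multiples0 : int_multiples d 0.
Proof. by exists 0 => //; rewrite mul0r. Qed.

Lemma int_multiplesB x y :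
  int_multiples d x -> int_multiples d y -> int_multiples d (x - y).
Proof.
by move=> [i _ <-] [j _ <-]; exists (i - j) => //; rewrite intrB mulrBl.
Qed.

Lemma int_multiplesD x y :
  int_multiples d x -> int_multiples d y -> int_multiples d (x + y).
Proof.
by move=> [i _ <-] [j _ <-]; exists (i + j) => //; rewrite intrD mulrDl.
Qed.

Lemma int_multiples_sum (I : finType) (P : pred I) (F : I -> R) :
  (forall i, P i -> int_multiples d (F i)) ->
  int_multiples d (\sum_(i | P i) F i).
Proof.
move=> h; apply: (big_ind (int_multiples d)) => //.
  exact: int_multiples0.
exact: int_multiplesD.
Qed.

Lemma bigcup_hyperplaneE (t : nat) (n x : 'rV[R]_t) (alpha : R) :
  (\bigcup_(j in [set: int]) hyperplane n alpha d j) x <->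
  int_multiples d (dot x n - alpha).
Proof.
split=> [[j _ e]|[j _ e]]; exists j => //.
  by rewrite e addrC addKr.
by rewrite /hyperplane /= e addrC subrK.
Qed.

End IntMultiples.

Lemma dotBl (R : realType) (t : nat) (x y n : 'rV[R]_t) :
  dot x n - dot y n = \sum_k (x 0 k - y 0 k) * n 0 k.
Proof. by rewrite /dot -sumrB; apply: eq_bigr => k _; rewrite mulrBl. Qed.

(** The part of the argument which does not depend on how the sequence is
    obtained: arbitrary branching after contexts of every length excludes the
    lattice structure. *)
Lemma branching_not_lattice (R : realType) (Z : prng) :
  (forall (l : nat) (a b : int), output Z a -> output Z b ->
    exists i j, [/\ forall k, (k < l)%N -> Z (i + k)%N = Z (j + k)%N,
      Z (i + l)%N = a & Z (j + l)%N = b]) ->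
  ~ lattice_structure R Z.
Proof.
move=> branch [t [_ [n [alpha [d [_ _ windowsH cubeNH]]]]]].
pose win i : 'rV[R]_t := \row_(k < t) (Z (i + k)%N)%:~R.
have winH i : int_multiples d (dot (win i) n - alpha).
  by apply/bigcup_hyperplaneE/windowsH; exists i.
have winB i j : int_multiples d (dot (win i) n - dot (win j) n).
  have -> : dot (win i) n - dot (win j) n =
      (dot (win i) n - alpha) - (dot (win j) n - alpha).
    by rewrite opprB addrA subrK.
  exact: int_multiplesB.
have coord (k : 'I_t) (a b : int) : output Z a -> output Z b ->
    int_multiples d ((a%:~R - b%:~R) * n 0 k).
  (* Descending induction on [k], with [s] a bound on [t - k]. *)
  move: {2}(t - k)%N (leqnn (t - k)) => s.
  elim: s k a b => [|s IH] k a b.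
    by rewrite leqn0 subn_eq0 leqNgt ltn_ord.
  move=> ks Za Zb; have [i [j [eij Zi Zj]]] := branch k a b Za Zb.
  have := winB i j; rewrite dotBl (bigD1 k)//= !mxE Zi Zj => ij.
  rewrite -[X in int_multiples d X](addrK (\sum_(h < t | h != k)
    (win i 0 h - win j 0 h) * n 0 h)).
  apply: int_multiplesB ij _; apply: int_multiples_sum => h hk; rewrite !mxE.
  have [lt|lt|/val_inj e] := ltngtP (h : nat) k.
  - by rewrite eij// subrr mul0r; apply: int_multiples0.
  - apply: IH; [|by eexists|by eexists].
    by rewrite -ltnS; apply: leq_trans ks; apply: ltn_sub2l.
  - by rewrite e eqxx in hk.
apply: cubeNH => _ [A MA <-]; apply/bigcup_hyperplaneE.
rewrite -[X in dot X n - _](subrK (win 0%N)).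
set x := \row_i _.
have -> : dot (x - win 0%N + win 0%N) n - alpha =
    (dot x n - dot (win 0%N) n) + (dot (win 0%N) n - alpha).
  by rewrite subrK addrA subrK.
apply: int_multiplesD => //; rewrite dotBl; apply: int_multiples_sum => k _.
by rewrite !mxE; apply: coord => //; eexists.
Qed.

Theorem theorem2p4 (R : realType) (M : set nat) (M_fin : finite_set M)
    (m : nat) (m_gt0 : (0 < m)%N) (X Y : prng)
    (X_out : output X = [set a%:Z | a in M])
    (Y_out : output Y = [set a%:Z | a in M])
    (X_per : has_period X m) (Y_per : has_period Y m)
    (u : infword 'I_2) (u_welldoc : WELLDOC u) :
  ~ lattice_structure R (combine u X Y).
Proof.
have YX : output Y = output X by rewrite X_out Y_out.
apply: branching_not_lattice => l a b /output_combine Za /output_combine Zb.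
rewrite YX setUid in Za Zb.
by apply: (combine_branch (m := m)); rewrite ?YX.
Qed.
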